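(* $\mathrm{SCM}(6,3;4;7,2,3)=\mathrm{RE}$. That is, a language is recursively enumerable if and only if it is generated by an SCM grammar with all of the following properties: - degree $(6,3)$; - at most $4$ nonterminals; - at most $7$ conditional matrices; - all matrices of length at most $2$; - at most $3$ non-simple matrices.
   Context: A semi-conditional matrix (SCM) grammar is a quadruple $G=(V,T,M,S)$ with the following components. - $V$ is a finite alphabet and $T\subsetneq V$ is the set of terminals. - $N=V\setminus T$ is the set of nonterminals and $S\in N$ is the start symbol. - $M$ is a finite set of matrices of the form $r=[(A_1\to x_1),\dots,(A_\ell\to x_\ell),P,F]$, where $\ell\ge 1$, $A_k\in N$, $x_k\in V^*$, and $P,F\in V^+\cup\{\emptyset\}$. Here $\emptyset\notin V$ is a special symbol meaning that the condition is absent, and $|\emptyset|=0$. The number $\ell$ is the length of $r$. A matrix is classified as follows: - unconditional if $P=F=\emptyset$, and conditional otherwise; - simple if at least one of $P,F$ equals $\emptyset$, and non-simple if both $P\neq\emptyset$ and $F\neq\emptyset$. For $x,y\in V^*$ we write $x\Rightarrow_r y$ iff all of the following hold: 1. if $P\neq\emptyset$ then $P$ is a subword (factor) of $x$; 2. if $F\neq\emptyset$ then $F$ is not a subword of $x$; 3. there are words $x=y_0,y_1,\dots,y_\ell=y$ such that $y_k$ is obtained from $y_{k-1}$ by replacing one occurrence of $A_k$ by $x_k$. $\Rightarrow_G$ is the union of the relations $\Rightarrow_r$ over $r\in M$, and $L(G)=\{y\in T^*: S\Rightarrow_G^* y\}$. $G$ has degree $(i,j)$ if every matrix satisfies $|P|\le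 i$ and $|F|\le j$. $\mathrm{SCM}(i,j;n;m,\ell,s)$ denotes the family of languages $L(G)$ of SCM grammars $G$ that satisfy all of the following: - $G$ has degree $(i,j)$; - $|N|\le n$; - $G$ has at most $m$ conditional matrices; - every matrix of $G$ has length at most $\ell$; - $G$ has at most $s$ non-simple matrices. A $*$ in a parameter position means that parameter is unbounded. $\mathrm{SSCM}(i,j;n;m,\ell)=\mathrm{SCM}(i,j;n;m,\ell,0)$, i.e., all matrices are simple. $\mathrm{RE}$ is the class of recursively enumerable languages. *)

(* Defs.v *)
From Stdlib Require List.
From mathcomp Require Import all_boot.
Set Implicit Arguments.
Unset Strict Implicit.
Unset Printing Implicit Defensive.

(* Symbols of a grammar with terminal alphabet T and nonterminals N:
   V = T + N (so T is a proper subset of V as soon as N is nonempty). *)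
Definition sym (T N : finType) := (T + N)%type.

Inductive star (A : Type) (R : A -> A -> Prop) : A -> A -> Prop :=
| star_refl x : star R x x
| star_step x y z : R x y -> star R y z -> star R x z.

Section SCM.
Variables (T N : finType).
Local Notation V := (sym T N).

Definition rewrite1 (A : N) (w : seq V) (x y : seq V) : Prop :=
  exists u v : seq V, x = u ++ inr A :: v /\ y = u ++ w ++ v.

Fixpoint apply_rules (rs : seq (N * seq V)) (x y : seq V) : Prop :=
  match rs with
  | [::] => x = y
  | (A, w) :: rs' => exists z, rewrite1 A w x z /\ apply_rules rs' z y
  end.

(* A matrix [(A1->x1),...,(Al->xl), P, F]; None encodes the symbol "emptyset". *)
Record matrix := Matrix {
  mrules : seq (N * seq V);
  mP : option (seq V);
  mF : option (seq V) }.

Definition cond_size (c : option (seq V)) : nat :=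
  if c is Some w then size w else 0.

Definition matrix_wf (r : matrix) : Prop :=
  0 < size (mrules r) /\
  (forall w, mP r = Some w -> 0 < size w) /\
  (forall w, mF r = Some w -> 0 < size w).

Definition conditional (r : matrix) : bool :=
  isSome (mP r) || isSome (mF r).

Definition non_simple (r : matrix) : bool :=
  isSome (mP r) && isSome (mF r).

Definition mstep (r : matrix) (x y : seq V) : Prop :=
  (forall P, mP r = Some P -> infix P x) /\
  (forall F, mF r = Some F -> ~~ infix F x) /\
  apply_rules (mrules r) x y.

Definition gstep (M : seq matrix) (x y : seq V) : Prop :=
  exists2 r, List.In r M & mstep r x y.

End SCM.

Arguments Matrix {T N}.

Record scm_grammar (T : finType) := SCMGrammar {
  scm_N : finType;
  scm_S : scm_N;
  scm_M : seq (matrix T scm_N) }.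

Definition scm_wf (T : finType) (G : scm_grammar T) : Prop :=
  forall r, List.In r (scm_M G) -> matrix_wf r.

Definition scm_lang (T : finType) (G : scm_grammar T) (y : seq T) : Prop :=
  star (@gstep T (scm_N G) (scm_M G)) [:: inr (scm_S G)] (map inl y).

Definition SCM (i j n m l s : nat) (T : finType) (L : seq T -> Prop) : Prop :=
  exists G : scm_grammar T,
    [/\ scm_wf G,
        (forall r, List.In r (scm_M G) ->
           cond_size (mP r) <= i /\ cond_size (mF r) <= j /\ size (mrules r) <= l),
        #|scm_N G| <= n,
        count (@conditional _ _) (scm_M G) <= m &
        count (@non_simple _ _) (scm_M G) <= s] /\
    (forall y, L y <-> scm_lang G y).

(* Recursively enumerable languages: generated by phrase-structure
   (type-0, unrestricted Chomsky) grammars alpha -> beta, alpha in V* N V*. *)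
Record ps_grammar (T : finType) := PSGrammar {
  ps_N : finType;
  ps_S : ps_N;
  ps_P : seq (seq (sym T ps_N) * seq (sym T ps_N)) }.

Definition ps_wf (T : finType) (G : ps_grammar T) : Prop :=
  forall p, p \in ps_P G -> exists A : ps_N G, inr A \in p.1.

Definition ps_step (T : finType) (G : ps_grammar T) (x y : seq (sym T (ps_N G))) : Prop :=
  exists p u v, [/\ p \in ps_P G, x = u ++ p.1 ++ v & y = u ++ p.2 ++ v].

Definition ps_lang (T : finType) (G : ps_grammar T) (y : seq T) : Prop :=
  star (@ps_step T G) [:: inr (ps_S G)] (map inl y).

Definition RE (T : finType) (L : seq T -> Prop) : Prop :=
  exists G : ps_grammar T, ps_wf G /\ forall y, L y <-> ps_lang G y.

(* Main.v *)
Require Import Defs.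
From mathcomp Require Import all_boot.

(** From a phrase-structure grammar: the nonterminals are S, two bits A and B,
    and a centre C.  Unconditional rules at S generate a word [y v C cr(u)],
    where [y] is terminal, [u] and [v] are bit strings and [cr] reverses and
    complements; afterwards the factors A C B and B C A have to be contracted
    to C, which eats up everything but [y] exactly when [u = v].  A contraction
    of [b C ~b] rewrites some [~b] to C and some [b] to CCAC.  The result
    contains CCACCC only if these were the two neighbours of the centre: the
    order in which the three parts meet rules out two letters on the same
    side.  Only then can A and one C be erased, and leaving a wrong A in place
    preserves the factor CAC, which blocks every further matrix.  The equation
    [u = v] expresses a derivation of [y], in the style of Post's
    correspondence problem: with rows separated by #, [u] is the row [y]
    followed by its predecessors, and [v] is the same list with every row
    obtained from the following one by applying rules.

    Conversely, a phrase-structure grammar executes a matrix with a head that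
    walks along the word between two end markers; a forbidden factor is
    excluded by letting the head look ahead at each position. *)

Set Implicit Arguments.
Unset Strict Implicit.
Unset Printing Implicit Defensive.

(** * Words split at a letter, and derivations *)

(** As [c] is absent from [a], the occurrence displayed on the right is the first one; the one on
    the left is either this occurrence or a later one. *)
Lemma cat_cons_split (V : eqType) (c : V) (p q a e : seq V) :
  c \notin a -> p ++ c :: q = a ++ c :: e ->
  (p = a /\ q = e) \/ exists p', p = a ++ c :: p' /\ e = p' ++ c :: q.
Proof.
elim: a p => [|x a IHa] [|z p] //=.
- by move=> _ [->]; left.
- by move=> _ [-> <-]; right; exists p.
- by rewrite inE negb_or => /andP[/eqP xc _] [].
rewrite inE negb_or => /andP[_ ca] [-> /(IHa _ ca)[[-> ->]|[p' [-> ->]]]].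
  by left.
by right; exists p'.
Qed.

Lemma cat_cons_catP (V : Type) (x : V) (p q a e : seq V) :
  p ++ x :: q = a ++ e ->
  (exists2 a', a = p ++ x :: a' & q = a' ++ e) \/
  (exists2 p', p = a ++ p' & e = p' ++ x :: q).
Proof.
elim: a p => [|y a IHa] [|z p] /=.
- by move=> <-; right; exists [::].
- by move=> <-; right; exists (z :: p).
- by case=> <- ->; left; exists a.
case=> -> /IHa [[a' -> ->]|[p' -> ->]]; first by left; exists a'.
by right; exists p'.
Qed.

Lemma infix_count (V : eqType) (a : pred V) (s t : seq V) :
  infix s t -> count a s <= count a t.
Proof.
by case/infixP=> p [q ->]; rewrite !count_cat addnCA leq_addr.
Qed.

Lemma star_trans (A : Type) (R : A -> A -> Prop) x y z :
  star R x y -> star R y z -> star R x z.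
Proof. by move=> xy; elim: xy z => // a b c ab _ IH z /IH; apply: star_step. Qed.

Lemma star_one (A : Type) (R : A -> A -> Prop) x y : R x y -> star R x y.
Proof. by move=> xy; apply: star_step xy (star_refl _ _). Qed.

(** * Contracting complementary pairs at the centre *)

Section PieceGrammar.
Variable T : finType.

Definition nt4 : finType := option (option bool).
Local Notation V := (sym T nt4).
Local Notation S := (inr None : V).
Local Notation C := (inr (Some None) : V).
Local Notation bit b := (inr (Some (Some b)) : V).
Local Notation A := (bit true).

Definition spawn (w : seq V) : matrix T nt4 := Matrix [:: (None, w)] None None.

(** On the two neighbours of the centre the outcome is CCAC, C, C, the factor that [unmark] asks
    for; forbidding CC excludes a centre that is a longer block. *)
Definition mark (b : bool) : matrix T nt4 :=
  Matrix [:: (Some (Some (~~ b)), [:: C]); (Some (Some b), [:: C; C; A; C])]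
    (Some [:: bit b; C; bit (~~ b)]) (Some [:: C; C]).

Definition unmark : matrix T nt4 :=
  Matrix [:: (Some (Some true), [::]); (Some None, [::])]
    (Some [:: C; C; A; C; C; C]) None.

(** While a marking is unresolved, CAC occurs and no C can be erased. *)
Definition erase : matrix T nt4 :=
  Matrix [:: (Some None, [::])] None (Some [:: C; A; C]).

Definition emb (x : T + bool) : V :=
  match x with inl t => inl t | inr b => bit b end.

Definition mirror (u : seq bool) : seq V := [seq bit (~~ b) | b <- rev u].

Variables (pieces : seq (seq (T + bool) * seq bool)) (fin : seq bool).

Definition piece_matrix (p : seq (T + bool) * seq bool) : matrix T nt4 :=
  spawn (map emb p.1 ++ S :: mirror p.2).

Definition piece_grammar : scm_grammar T :=
  @SCMGrammar T nt4 None
    (map piece_matrix pieces ++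
     [:: spawn (map emb (map inr fin) ++ [:: C]);
         mark true; mark false; unmark; erase]).

Local Notation step := (gstep (scm_M piece_grammar)).

(** * Derivations after the centre has appeared *)

Definition bitp (x : V) : bool := if x is inr (Some (Some _)) then true else false.
Definition plain (x : V) : bool := if x is inl _ then true else bitp x.
Definition flip (x : V) : V :=
  match x with inr (Some (Some b)) => bit (~~ b) | _ => x end.

Lemma bit_plain s : all bitp s -> all plain s.
Proof. by apply: sub_all => -[?|[[?|]|]]. Qed.

Lemma plainC s : all plain s -> C \notin s.
Proof. by move=> /allP h; apply/negP => /h. Qed.

Lemma plainS s : all plain s -> S \notin s.
Proof. by move=> /allP h; apply/negP => /h. Qed.

Lemma count_plain s : all plain s -> count_mem C s = 0.
Proof. by move/plainC/count_memPn. Qed.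

Lemma rewrite1_mem (X : nt4) w (x y : seq V) : rewrite1 X w x y -> inr X \in x.
Proof. by case=> u [v [-> _]]; rewrite mem_cat inE eqxx orbT. Qed.

Lemma step_cases s t : S \notin s -> step s t ->
  [\/ exists b, mstep (mark b) s t, mstep unmark s t | mstep erase s t].
Proof.
move=> Ss [r rM st].
have spawnF w : r = spawn w -> False.
  move=> rw; case: st => _ [_]; rewrite rw /= => -[z [/rewrite1_mem h _]].
  by rewrite h in Ss.
have [/List.in_map_iff [p [rp _]]|/=] := List.in_app_or _ _ _ rM.
  by case: (spawnF _ (esym rp)).
case=> [rw|]; first by case: (spawnF _ (esym rw)).
case=> [rw|]; first by rewrite -rw in st; apply: Or31; exists true.
case=> [rw|]; first by rewrite -rw in st; apply: Or31; exists false.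
case=> [rw|]; first by rewrite -rw in st; apply: Or32.
by case=> [rw|//]; rewrite -rw in st; apply: Or33.
Qed.

(* Only [unmark] could act on a word that contains CAC and CC. *)
Definition dead (s : seq V) : Prop :=
  [/\ S \notin s, infix [:: C; A; C] s, infix [:: C; C] s &
      ~~ infix [:: C; C; A; C; C; C] s].

Lemma dead_stuck s t : dead s -> step s t -> False.
Proof.
case=> Ss cac cc ccaccc /(step_cases Ss) [[b]|[/(_ _ erefl)]|].
- by case=> _ [/(_ _ erefl)]; rewrite cc.
- by rewrite (negPf ccaccc).
- by case=> _ [/(_ _ erefl)]; rewrite cac.
Qed.

(** All C's lie in one block, so it does not matter which of them is erased. *)
Lemma erase_center l k r p q :
  all plain l -> all plain r -> l ++ nseq k C ++ r = p ++ C :: q ->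
  0 < k /\ p ++ q = l ++ nseq k.-1 C ++ r.
Proof.
move=> + pr; elim: l p => [|x l IHl] [|z p] /=.
- case: k => [|k] /= _ rE; first by rewrite rE in pr.
  by case: rE => <-.
- case: k => [|k] _ /= rE; first by rewrite rE /= all_cat /= !andbF in pr.
  case: rE => <- {z}; elim: k p => [|k IHk] [|z p] /= rE.
  + by rewrite rE in pr.
  + by rewrite rE /= all_cat /= !andbF in pr.
  + by case: rE => <-.
  + by case: rE => <- /IHk [_ ->].
- by case/andP=> px _ [xC]; move: px; rewrite xC.
- by case/andP=> _ pl [-> /(IHl _ pl)[-> ->]].
Qed.

Lemma plain_rem p X q : all plain (p ++ X :: q) -> all plain (p ++ q).
Proof. by rewrite !all_cat /= => /and3P[-> _ ->]. Qed.

(** CC blocks [mark] and CAC blocks [erase]. If [unmark] takes an A other than the one in the block,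
    CAC and CC survive, but too few C's remain for a second [unmark]. *)
Lemma armed_step l r t : all plain l -> all plain r ->
  step (l ++ [:: C; C; A; C; C; C] ++ r) t ->
  dead t \/ t = l ++ nseq 4 C ++ r.
Proof.
move=> pl pr.
have Ss : S \notin l ++ [:: C; C; A; C; C; C] ++ r.
  by rewrite !mem_cat !negb_or plainS // plainS.
case/(step_cases Ss) => [[b]|[_ [_ /=]]|].
- case=> _ [/(_ _ erefl)]; case/negP.
  by apply/infixP; exists l, ([:: A; C; C; C] ++ r); rewrite -?catA.
- case=> s1 [[p [q [sE ->]]] [s2 [[p' [q' [s1E ->]]] <-]]] /=.
  have deadI l' r' : all plain l' -> all plain r' ->
    p ++ q = l' ++ [:: C; C; A; C; C; C] ++ r' -> dead (p' ++ q').
  + move=> pl' pr' E.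
    (* One of the five C's is erased, and CCACCC needs five. *)
    have cnt : count_mem C (p' ++ q') = 4.
      have : count_mem C (p' ++ C :: q') = 5.
        by rewrite -s1E /= E !count_cat (count_plain pl') (count_plain pr').
      by rewrite !count_cat /= addnCA => -[].
    have Sq : S \notin p' ++ q'.
      have : S \notin p' ++ C :: q'.
        by rewrite -s1E /= E !mem_cat !negb_or plainS // plainS.
      by rewrite !mem_cat inE.
    have noC : ~~ infix [:: C; C; A; C; C; C] (p' ++ q').
      by apply/negP => /(@infix_count _ (pred1 C)); rewrite cnt.
    suff [] : infix [:: C; A; C] (p' ++ q') /\ infix [:: C; C] (p' ++ q') by split.
    move: s1E; rewrite /= E => /esym.
    (* The erased C lies before the A of the block ([W1]) or after it ([W2]). *)
    have W1 : infix [:: C; A; C] (l' ++ [:: C; A; C; C; C] ++ r') /\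
              infix [:: C; C] (l' ++ [:: C; A; C; C; C] ++ r').
      split; apply/infixP; first by exists l', ([:: C; C] ++ r').
      by exists (l' ++ [:: C; A]), ([:: C] ++ r'); rewrite -?catA.
    have W2 : infix [:: C; A; C] (l' ++ [:: C; C; A; C; C] ++ r') /\
              infix [:: C; C] (l' ++ [:: C; C; A; C; C] ++ r').
      split; apply/infixP; first by exists (l' ++ [:: C]), ([:: C] ++ r'); rewrite -?catA.
      by exists l', ([:: A; C; C] ++ r').
    case/(cat_cons_split (plainC pl')) => [[-> ->]|[x [-> /esym]]] //=.
    case/(@cat_cons_split _ C _ _ [::] _ isT) => [[-> ->]|[{}x [-> /esym]]] //=.
      by rewrite cats1 -cats1 -?catA.
    case/(@cat_cons_split _ C _ _ [:: A] _ isT) => [[-> ->]|[{}x [-> /esym]]] //=.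
      by rewrite -?catA.
    case/(@cat_cons_split _ C _ _ [::] _ isT) => [[-> ->]|[{}x [-> /esym]]] //=.
      by rewrite -?catA.
    case/(@cat_cons_split _ C _ _ [::] _ isT) => [[-> ->]|[{}x [-> rE]]] //=.
      by rewrite -?catA.
    by move: (plainC pr'); rewrite rE mem_cat inE eqxx orbT.
  (* The erased A lies in [l], in the block, or in [r]. *)
  have [[l' lE qE]|[p2 pE /esym mE]] := cat_cons_catP (esym sE).
    left; apply: (deadI (p ++ l') r) => //; last by rewrite qE catA.
    by apply: (@plain_rem _ A); rewrite -lE.
  have [[M ME qE]|[p3 p2E rE]] := @cat_cons_catP _ _ _ _ [:: C; C; A; C; C; C] _ mE; last first.
    left; apply: (deadI l (p3 ++ q)) => //; last by rewrite pE p2E -?catA.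
    by apply: (@plain_rem _ A); rewrite -rE.
  have {}ME : p2 = [:: C; C] /\ M = [:: C; C; C].
    have [//|[p3 [_ CE]]] := @cat_cons_split _ A p2 M [:: C; C] [:: C; C; C] isT (esym ME).
    by have : A \in [:: C; C; C] by rewrite CE mem_cat inE eqxx orbT.
  right; move: s1E; rewrite pE qE; case: ME => -> -> => s1E.
  by case: (@erase_center l 5 r p' q' pl pr); rewrite // -s1E -?catA.
case=> _ [/(_ _ erefl)]; case/negP.
by apply/infixP; exists (l ++ [:: C]), ([:: C; C] ++ r); rewrite -?catA.
Qed.

Lemma mem_center (p q : seq V) : C \in p ++ C :: q.
Proof. by rewrite mem_cat inE eqxx orbT. Qed.

(** [mark] needs a C but no CC, hence [k = 1]; [unmark] needs five C's, hence the bound 4 on [k]. *)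
Lemma center_step l k r t : all plain l -> all plain r -> k <= 4 ->
  step (l ++ nseq k C ++ r) t ->
  [\/ dead t, 0 < k /\ t = l ++ nseq k.-1 C ++ r |
      exists l' b r', [/\ k = 1, l = rcons l' (bit b), r = bit (~~ b) :: r' &
        t = l' ++ [:: C; C; A; C; C; C] ++ r']].
Proof.
move=> pl pr k4.
have Sk : S \notin l ++ nseq k C ++ r.
  by rewrite !mem_cat !negb_or (plainS pl) (plainS pr) mem_nseq andbF.
have countk : count_mem C (l ++ nseq k C ++ r) = k.
  by rewrite !count_cat (count_plain pl) (count_plain pr) count_nseq mul1n addn0.
have [Cl Cr] := (plainC pl, plainC pr).
case/(step_cases Sk) => [[b]|[/(_ _ erefl)]|[_ [_ [s1 [[p [q [/= sE ->]]] <-]]]]].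
- case=> /(_ _ erefl) hP [/(_ _ erefl) hF].
  have k1 : k = 1.
    move: (@infix_count _ (pred1 C) _ _ hP); rewrite countk /=.
    case: {+}k hF => [|[|k']] // /negP[]; apply/infixP.
    by exists l, (nseq k' C ++ r).
  subst k; move: hP => /infixP[a [e sE]] /=.
  have := @cat_cons_split _ C (a ++ [:: bit b]) (bit (~~ b) :: e) l r Cl.
  rewrite -catA /= => /(_ (esym sE)) [[lE rE]|[p' [_ rE]]]; last first.
    by rewrite rE mem_center in Cr.
  case=> s1 [[p1 [q1 [sE1 s1E]]] [s2 [[p [q [s1E' ->]]] <-]]] {s2}.
  have Sp : S \notin p ++ [:: C; C; A; C] ++ q.
    have : S \notin p1 ++ bit (~~ b) :: q1 by rewrite -sE1.
    have : S \notin p ++ bit b :: q -> S \notin p ++ [:: C; C; A; C] ++ q.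
      by rewrite !mem_cat !inE.
    by rewrite -s1E' s1E !mem_cat !inE => h /h.
  (* The inserted CCAC brings CAC and CC, so without CCACCC the word is dead. *)
  have [ccaccc|ccaccc] := boolP (infix [:: C; C; A; C; C; C] (p ++ [:: C; C; A; C] ++ q)).
    apply: Or33; case/infixP: ccaccc => a' [e' tE].
    (* The word had one C and gains four, so all of them lie in CCACCC. *)
    have c1 : count_mem C (p1 ++ bit (~~ b) :: q1) = 1 by rewrite -sE1 countk.
    have c2 : count_mem C (p ++ bit b :: q) = 2.
      by rewrite -s1E' s1E; move: c1; rewrite !count_cat /= addnCA add0n addn0 addnCA => ->.
    have c5 : count_mem C (a' ++ [:: C; C; A; C; C; C] ++ e') = 5.
      by rewrite -tE; move: c2; rewrite !count_cat /= addnCA add0n addnCA => ->.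
    have {c5} [Ca Ce] : C \notin a' /\ C \notin e'.
      move: c5; rewrite !count_cat /= addnCA => -[] /eqP.
      by rewrite !add0n addn_eq0 => /andP[/eqP a0 /eqP e0]; split; apply/count_memPn.
    (* With no other C around, the inserted CCAC must begin the factor; the last two C's are the old
       centre and the rewritten complement, in some order. *)
    have {Sp} [pE qE] : p = a' /\ q = [:: C; C] ++ e'.
      move: tE; case/(cat_cons_split Ca) => [[-> [->]]|[x [_ /esym]]] //=.
      case/(@cat_cons_split _ C _ _ [::] _ isT) => [[_]|[{}x [_ /esym]]] //=.
      case/(@cat_cons_split _ C _ _ [:: A] _ isT) => [[_]|[{}x [_ /esym]]] //=.
      case/(@cat_cons_split _ C _ _ [::] _ isT) => [[_ eE]|[{}x [_ /esym]]] //=.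
        by case: eE => eE; rewrite -eE !inE in Ce.
      case/(@cat_cons_split _ C _ _ [::] _ isT) => [[_ eE]|[{}x [_ eE]]] //=.
        by rewrite -eE !inE in Ce.
      by rewrite eE mem_center in Ce.
    move: s1E'; rewrite s1E pE qE /= => s1E'.
    have Cab : C \notin a' ++ [:: bit b] by rewrite mem_cat negb_or Ca.
    have := @cat_cons_split _ C p1 q1 _ (C :: e') Cab.
    rewrite -catA /= => /(_ s1E') [[p1E q1E]|[x [p1E /esym]]].
      (* If the first of these two C's came from the complement, [l] would end in [bit (~~ b)], but
         it ends in [bit b]. *)
      have := @cat_cons_split _ C (p1 ++ [:: bit (~~ b)]) e' l r Cl.
      rewrite q1E in sE1; rewrite -catA /= => /(_ (esym sE1)) [[lE' _]|[x [_ rE']]]; last first.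
        by rewrite rE' mem_center in Cr.
      by move: lE'; rewrite -lE p1E !cats1 => /rcons_inj[_ /eqP]; case: (b).
    case/(@cat_cons_split _ C _ _ [::] _ isT) => [[x0 q1E]|[y [_ eE]]]; last first.
      by rewrite eE mem_center in Ce.
    have := @cat_cons_split _ C (a' ++ [:: bit b]) (bit (~~ b) :: q1) l r Cl.
    move: sE1; rewrite p1E x0 -!catA /= => sE1 /(_ (esym sE1)) [[{}lE {}rE]|[y [_ rE']]].
      by exists a', b, q1; rewrite -lE -rE cats1 q1E.
    by rewrite rE' mem_center in Cr.
  apply: Or31; split=> //; apply/infixP.
    by exists (p ++ [:: C]), q; rewrite -?catA.
  by exists p, ([:: A; C] ++ q); rewrite -?catA.
- by move/(@infix_count _ (pred1 C)); rewrite countk /= => /leq_trans/(_ k4).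
- have [k0 tE] := erase_center pl pr sE; apply: Or32; split=> //.
Qed.

(** Induction from the end of the derivation: marking and unmarking strip complementary bits from
    the inner ends of [l] and [r], and erasing a C changes neither, so the relation with [y] is
    carried back to [s]. *)
Lemma star_center s t : star step s t -> forall y : seq T, t = map inl y ->
  [/\ ~ dead s,
      forall l r, all plain l -> all bitp r ->
        s = l ++ [:: C; C; A; C; C; C] ++ r -> l = map inl y ++ rev (map flip r) &
      forall l k r, all plain l -> all bitp r -> k <= 4 ->
        s = l ++ nseq k C ++ r -> l = map inl y ++ rev (map flip r)].
Proof.
elim=> [{}s|{}s s1 {}t ss1 _ IH] y tE.
- have Cy : C \notin s by rewrite tE; apply/negP => /mapP[].
  split.
  + by case=> _ /infixP[p [q sE]]; rewrite sE mem_center in Cy.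
  + by move=> l r _ _ sE; rewrite sE mem_center in Cy.
  + move=> l [|k] r _ br _ sE; last by rewrite sE mem_center in Cy.
    (* With no C left, a nonempty [r] would put a bit into the terminal word. *)
    case: r br sE => [|x r] /=; first by rewrite !cats0 => _ <-.
    case/andP=> bx _ sE.
    have : x \in s by rewrite sE mem_cat inE eqxx orbT.
    by rewrite tE => /mapP[z _ xz]; rewrite xz in bx.
have [dead1 armed1 center1] := IH y tE; split.
- by move/dead_stuck => /(_ _ ss1).
- move=> l r pl br sE.
  rewrite sE in ss1; have [//|s1E] := armed_step pl (bit_plain br) ss1.
  exact: center1 s1E.
move=> l k r pl br k4 sE.
rewrite sE in ss1.
have [//|[_]|] := center_step pl (bit_plain br) k4 ss1.
  by move/center1 ->; rewrite // (leq_trans (leq_pred _)).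
case=> l' [b [r' [_ lE rE s1E]]].
rewrite lE all_rcons in pl; case/andP: pl => _ pl.
move: br; rewrite rE => /= br'.
by rewrite lE (armed1 l' r' pl br' s1E) rev_cons negbK rcons_cat.
Qed.

(** * The generating phase *)

Lemma plain_emb s : all plain (map emb s).
Proof. by elim: s => [|[t|b] s IHs]. Qed.

Lemma bit_mirror u : all bitp (mirror u).
Proof. by rewrite /mirror; elim: (rev u). Qed.

Lemma mirror_cat u v : mirror (u ++ v) = mirror v ++ mirror u.
Proof. by rewrite /mirror rev_cat map_cat. Qed.

Lemma flip_mirror u : rev (map flip (mirror u)) = map emb (map inr u).
Proof.
rewrite /mirror -!map_comp -map_rev revK.
by apply: eq_map => b /=; rewrite negbK.
Qed.

Lemma emb_inj : injective emb.
Proof. by move=> [t|b] [t'|b'] // [->]. Qed.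

Definition lefts (ps : seq (seq (T + bool) * seq bool)) := flatten (map fst ps).
Definition rights (ps : seq (seq (T + bool) * seq bool)) := flatten (map snd ps).

(** The word has no C yet, and every conditional matrix needs one, in its required factor or for
    rewriting. *)
Lemma spawn_step l u t : all plain l -> all plain u ->
  step (l ++ S :: u) t ->
  (exists2 p, List.In p pieces & t = (l ++ map emb p.1) ++ S :: mirror p.2 ++ u) \/
  t = (l ++ map emb (map inr fin)) ++ C :: u.
Proof.
move=> pl pu [r rM st].
have C0 : C \notin l ++ S :: u by rewrite mem_cat inE negb_or (plainC pl) (plainC pu).
have spawnE w : r = spawn w -> t = l ++ w ++ u.
  move=> rw; case: st => _ [_]; rewrite rw /= => -[z [[p [q [sE ->]]] <-]].
  have [[-> ->//]|[x [_ uE]]] := cat_cons_split (plainS pl) (esym sE).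
  by move: (plainS pu); rewrite uE mem_cat inE eqxx orbT.
have condF w : mP r = Some w -> C \in w -> False.
  case: st => cond _ /cond /infixP[p [q sE]] Cw.
  by move: C0; rewrite sE !mem_cat Cw orbT.
have [/List.in_map_iff [p [rp pP]]|/=] := List.in_app_or _ _ _ rM.
  by left; exists p => //; rewrite (spawnE _ (esym rp)) -!catA.
case=> [rw|]; first by right; rewrite (spawnE _ (esym rw)) -!catA.
case=> [rw|]; first by case: (condF [:: bit true; C; bit false]) => //; rewrite -rw.
case=> [rw|]; first by case: (condF [:: bit false; C; bit true]) => //; rewrite -rw.
case=> [rw|]; first by case: (condF [:: C; C; A; C; C; C]) => //; rewrite -rw.
case=> // rw; case: st => _ [_]; rewrite -rw /= => -[z [/rewrite1_mem h _]].
by rewrite h in C0.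
Qed.

(** Each piece extends both [l] and [u] at their ends, since [mirror] reverses; once S is replaced
    by C, [star_center] supplies the equation. *)
Lemma star_spawn s t : star step s t -> forall y l u,
  t = map inl y -> s = map emb l ++ S :: mirror u ->
  exists2 ps, forall p, List.In p ps -> List.In p pieces &
    l ++ lefts ps ++ map inr fin = map inl y ++ map inr (u ++ rights ps).
Proof.
elim=> [{}s|{}s s1 {}t ss1 st IH] y l u tE sE.
  suff : S \in map inl y by move/mapP=> [].
  by rewrite -tE sE mem_cat inE eqxx orbT.
rewrite sE in ss1.
case: (spawn_step (plain_emb l) (bit_plain (bit_mirror u)) ss1) => [[p pP s1E]|s1E].
  have [|ps psP E] := IH y (l ++ p.1) (u ++ p.2) tE.
    by rewrite s1E map_cat mirror_cat.
  exists (p :: ps) => [q /= [<-//|/psP//]|].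
  by rewrite /lefts /rights /= -!catA in E *; exact: E.
exists [::] => //; rewrite /lefts /rights /= cats0.
have [_ _ /(_ _ 1)] := star_center st tE.
rewrite -map_cat in s1E.
move=> /(_ _ _ (plain_emb _) (bit_mirror _) isT s1E).
rewrite flip_mirror => lE; apply: (inj_map emb_inj).
by rewrite lE map_cat -[map emb (map inl y)]map_comp.
Qed.

(** * Successful contractions *)

#[local] Arguments infix : simpl never.

Lemma infix_skip F a b : all plain a -> infix (C :: F) (a ++ b) = infix (C :: F) b.
Proof.
elim: a => //= x a IHa /andP[px /IHa <-].
by rewrite infix_consl /=; case: x px => [?|[[?|]|]].
Qed.

Lemma infix_plain F a : all plain a -> infix (C :: F) a = false.
Proof. by move=> pa; rewrite -[a]cats0 infix_skip. Qed.

Lemma in_scm_M r : List.In r [:: spawn (map emb (map inr fin) ++ [:: C]);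
         mark true; mark false; unmark; erase] -> List.In r (scm_M piece_grammar).
Proof. by move=> h; apply/List.in_or_app; right. Qed.

Lemma erase_step l r k : all plain l -> all plain r ->
  step (l ++ nseq k.+1 C ++ r) (l ++ nseq k C ++ r).
Proof.
move=> pl pr; exists erase; first by apply: in_scm_M; do 4!right; left.
split=> //; split=> [_ [<-]|]; last first.
  by exists (l ++ nseq k C ++ r); split=> //; exists l, (nseq k C ++ r).
(* [r] has no C, so CAC cannot begin at the last C of the block. *)
have noC (x : V) : prefix [:: x; C] r = false.
  by apply/negP => /prefixP[q rE]; move: (plainC pr); rewrite rE !inE eqxx orbT.
rewrite infix_skip //; elim: k => [|k IHk] /=.
  by rewrite infix_consl infix_plain //= noC.
by rewrite infix_consl negb_or IHk; case: (k).
Qed.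

Lemma mark_step l r b : all plain l -> all plain r ->
  step (l ++ bit b :: C :: bit (~~ b) :: r) (l ++ [:: C; C; A; C; C; C] ++ r).
Proof.
move=> pl pr; exists (mark b).
  by apply: in_scm_M; case: b; [do 1!right | do 2!right]; left.
split=> [_ [<-]|]; first by apply/infixP; exists l, r.
split=> [_ [<-]|].
  rewrite infix_skip // (@infix_skip _ [:: bit b]) // infix_consl /=.
  by rewrite (@infix_plain [:: C] (_ :: r)).
exists (l ++ [:: bit b; C; C] ++ r); split.
  by exists (l ++ [:: bit b; C]), r; rewrite -!catA.
by eexists; split; first by exists l, ([:: C; C] ++ r).
Qed.

Lemma unmark_step l r : step (l ++ [:: C; C; A; C; C; C] ++ r) (l ++ nseq 4 C ++ r).
Proof.
exists unmark; first by apply: in_scm_M; do 3!right; left.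
split=> [_ [<-]|]; first by apply/infixP; exists l, r.
split=> //; exists (l ++ nseq 5 C ++ r); split.
  by exists (l ++ [:: C; C]), ([:: C; C; C] ++ r); rewrite -!catA.
by eexists; split; first by exists l, (nseq 4 C ++ r).
Qed.

(** One round of [mark], [unmark] and three erasures removes the innermost pair of bits; hence the
    induction on the last bit of [u]. *)
Lemma star_match l u : all plain l ->
  star step (l ++ map emb (map inr u) ++ C :: mirror u) l.
Proof.
move=> pl; elim/last_ind: u => [|u b IHu].
  apply: star_one; rewrite -[X in step _ X]cats0.
  exact: (@erase_step l [::] 0).
rewrite -[rcons u b]cats1 mirror_cat !map_cat -catA /=.
apply: star_trans IHu; rewrite [l ++ _ ++ _]catA [l ++ _ ++ _]catA.
have plu : all plain (l ++ map emb (map inr u)) by rewrite all_cat pl plain_emb.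
have pu := bit_plain (bit_mirror u).
apply: star_step (mark_step b plu pu) _.
apply: star_step (unmark_step _ _) _.
do 3!apply: star_step (erase_step _ plu pu) _.
exact: star_refl.
Qed.

Lemma star_pieces ps l u : (forall p, List.In p ps -> List.In p pieces) ->
  star step (map emb l ++ S :: mirror u)
    (map emb (l ++ lefts ps) ++ S :: mirror (u ++ rights ps)).
Proof.
elim: ps l u => [|p ps IHps] l u psP.
  by rewrite /lefts /rights /= !cats0; apply: star_refl.
apply: star_step (_ : step _ (map emb (l ++ p.1) ++ S :: mirror (u ++ p.2))) _.
  exists (piece_matrix p).
    by apply/List.in_or_app; left; apply: List.in_map; apply: psP; left.
  split=> //; split=> //; eexists; split; first by exists (map emb l), (mirror u).
  by rewrite map_cat mirror_cat -!catA.
have := IHps (l ++ p.1) (u ++ p.2); rewrite /lefts /rights /= -!catA; apply.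
by move=> q qP; apply: psP; right.
Qed.

(** This reduces the language to a correspondence problem in which the same pieces build both
    sides. *)
Theorem piece_langP y : scm_lang piece_grammar y <->
  exists2 ps, forall p, List.In p ps -> List.In p pieces &
    lefts ps ++ map inr fin = map inl y ++ map inr (rights ps).
Proof.
split=> [st|[ps psP E]]; first exact: (@star_spawn _ _ st y [::] [::]).
apply: star_trans (@star_pieces ps [::] [::] psP) _ => /=.
apply: star_step (_ : step _ (map emb (lefts ps ++ map inr fin) ++ C :: mirror (rights ps))) _.
  exists (spawn (map emb (map inr fin) ++ [:: C])); first by apply: in_scm_M; left.
  split=> //; split=> //; eexists; split.
    by exists (map emb (lefts ps)), (mirror (rights ps)).
  by rewrite map_cat -!catA.
rewrite E map_cat -catA -[map emb (map inl y)]map_comp.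
by apply: star_match; elim: (y).
Qed.

End PieceGrammar.

(** * Encoding derivations *)

Section PrefixCode.
Variable X : finType.

(** Unary and closed by [false], hence a prefix code with nonempty code words. *)
Definition code (x : X) : seq bool := rcons (nseq (enum_rank x) true) false.
Definition codes (w : seq X) : seq bool := flatten (map code w).

Lemma codes_cat u v : codes (u ++ v) = codes u ++ codes v.
Proof. by rewrite /codes map_cat flatten_cat. Qed.

Lemma code_prefix x y s t : code x ++ s = code y ++ t -> x = y /\ s = t.
Proof.
rewrite /code !cat_rcons => E.
suff [/val_inj/enum_rank_inj-> ->] : enum_rank x = enum_rank y :> nat /\ s = t by [].
elim: (nat_of_ord _) (nat_of_ord (enum_rank y)) E => [|m IHm] [|n] //= [].
  by [].
by move/IHm => [-> ->].
Qed.

Lemma codes_inj : injective codes.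
Proof.
elim=> [|x u IHu] [|y v] //=.
- by rewrite /codes /= /code; case: (nseq _ _).
- by rewrite /codes /= /code; case: (nseq _ _).
by move/code_prefix=> [-> /IHu->].
Qed.

End PrefixCode.

(** * Derivations as a correspondence problem *)

Section FromPhraseStructure.
Variables (T : finType) (G : ps_grammar T).
Hypothesis Gwf : ps_wf G.
Local Notation W := (sym T (ps_N G)).
Local Notation start := (inr (ps_S G) : W).
Local Notation step := (@ps_step T G).

(* [None] separates the rows of a derivation. *)
Definition row := seq (option W).

(* In the outer option, [None] is a spacer. *)
Definition pre (w : row) : seq (option (option W)) :=
  flatten [seq [:: None; Some x] | x <- w].
Definition post (w : row) : seq (option (option W)) :=
  flatten [seq [:: Some x; None] | x <- w].

Lemma pre_cat u v : pre (u ++ v) = pre u ++ pre v.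
Proof. by rewrite /pre map_cat flatten_cat. Qed.

Lemma post_cat u v : post (u ++ v) = post u ++ post v.
Proof. by rewrite /post map_cat flatten_cat. Qed.

(** The two spacings differ only by one spacer at an end; this offset later forces the order of the
    items. *)
Lemma pre_post w : None :: post w = rcons (pre w) None.
Proof. by elim: w => //= x w <-. Qed.

(** A [Term] outputs a terminal and codes it in the first row of the right side; [Start] closes that
    row and switches from spacers before letters to spacers after them; a [Move] puts the right-hand
    side of a rule or a copied letter on the left, and what it came from on the right. *)
Inductive item := Term of T | Start | Move of row & row.

Definition item_term (i : item) : seq T := if i is Term a then [:: a] else [::].
Definition item_row (i : item) : row := if i is Move _ beta then beta else [::].
Definition item_code (i : item) : seq (option (option W)) :=
  match i with
  | Term a => [:: None; Some (Some (inl a))]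
  | Start => [:: None; Some None; None]
  | Move alpha _ => post alpha
  end.

Definition item_piece (i : item) : seq (T + bool) * seq bool :=
  (map inl (item_term i) ++ map inr (codes (pre (item_row i))), codes (item_code i)).

Definition moves : seq (row * row) :=
  [seq ([:: x], [:: x]) | x <- enum {: option W}] ++
  [seq (map Some p.1, map Some p.2) | p <- ps_P G].

Definition items : seq item :=
  map Term (enum T) ++ Start :: [seq Move m.1 m.2 | m <- moves].

Definition alphas (ms : seq (row * row)) : row := flatten (map fst ms).
Definition betas (ms : seq (row * row)) : row := flatten (map snd ms).

Lemma movesP m : List.In m moves ->
  (exists x, m = ([:: x], [:: x])) \/
  (exists2 p, p \in ps_P G & m = (map Some p.1, map Some p.2)).
Proof.
move/(List.in_app_or _ _ _) => [/List.in_map_iff [x [<- _]]|]; first by left; exists x.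
elim: (ps_P G) => [//|p ps IHps] /= [<-|/IHps [//|]].
- by right; exists p; rewrite ?inE ?eqxx.
- by move=> ?; left.
by case=> q qp ->; right; exists q; rewrite ?inE ?qp ?orbT.
Qed.

Lemma copy_move x : List.In ([:: x], [:: x]) moves.
Proof.
apply/List.in_or_app; left; apply/List.in_map_iff; exists x; split=> //.
have := mem_enum {: option W} x; elim: (enum _) => // z s IHs.
by rewrite inE => /orP[/eqP->|/IHs]; [left | right].
Qed.

Lemma rule_move p : p \in ps_P G -> List.In (map Some p.1, map Some p.2) moves.
Proof.
move=> pP; apply/List.in_or_app; right; apply/List.in_map_iff; exists p; split=> //.
by elim: (ps_P G) pP => // z s IHs; rewrite inE => /orP[/eqP->|/IHs]; [left | right].
Qed.

(** Left-hand sides of rules contain a nonterminal. Hence the code of a [Move] begins with a letter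
    and not with a spacer. *)
Lemma move_nonempty m : List.In m moves -> m.1 <> [::].
Proof.
case/movesP => [[x ->] //|[p /Gwf[X Xp] -> /=]].
by case: p.1 Xp.
Qed.

(** Sides of rules contain no separator, so a rule read here lies within the current row. *)
Lemma map_Some_split (w b : seq W) (r s : row) :
  map Some w ++ None :: r = map Some b ++ s ->
  exists2 w', w = b ++ w' & map Some w' ++ None :: r = s.
Proof.
elim: b w => [|x b IHb] [|z w] //=; first by move=> E; exists [::].
  by move=> E; exists (z :: w).
by case=> -> /IHb [w' -> <-]; exists w'.
Qed.

(* [w] is the unread part of the current row and [v] the part of the next row
   read so far. *)
Lemma moves_sound ms : (forall m, List.In m ms -> List.In m moves) ->
  forall w v : seq W,
  map Some w ++ None :: map Some v ++ alphas ms = betas ms ++ [:: Some start; None] ->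
  star step [:: start] (v ++ w).
Proof.
elim: ms => [_ w v|m ms IHms msP w v].
  rewrite /alphas /betas /= cats0.
  by case: w => [|x [|? ?]] // [->]; case: v => // _; apply: star_refl.
have {}IHms := IHms (fun m' h => msP m' (or_intror h)).
rewrite [alphas _]/(m.1 ++ alphas ms) [betas _]/(m.2 ++ betas ms) -catA.
have [[x ->]|[p pP ->]] := movesP (msP m (or_introl erefl)) => /=.
  (* If the row is used up, the separator is copied and the predecessor [v] becomes the current
     row. *)
  case: w => [[xE]|z w [xE]].
    by rewrite -xE cats0 => /(IHms v [::]).
  rewrite -xE => E; have := IHms w (v ++ [:: z]).
  by rewrite map_cat -!catA => /(_ E).
(* The predecessor grows by [p.1], and one rule application turns this factor into [p.2]. *)
case/map_Some_split => w' -> E; have := IHms w' (v ++ p.1).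
rewrite map_cat -!catA => /(_ E) st.
by apply: star_trans st (star_one _); exists p, v, w'.
Qed.

(** Each step of the derivation puts one more row in front: right-hand sides spell the new word and
    left-hand sides its predecessor. *)
Lemma moves_complete x w : star step x w ->
  (exists2 ms, forall m, List.In m ms -> List.In m moves &
     map Some x ++ None :: alphas ms = betas ms ++ [:: Some start; None]) ->
  exists2 ms, forall m, List.In m ms -> List.In m moves &
    map Some w ++ None :: alphas ms = betas ms ++ [:: Some start; None].
Proof.
elim=> // {}x y {}w [p [u [v [pP -> ->]]]] _ IH [ms msP E]; apply: IH.
pose copies (s : row) := [seq ([:: z], [:: z]) | z <- s].
have acopies s : flatten (map fst (copies s)) = s by elim: s => //= ? ? ->.
have bcopies s : flatten (map snd (copies s)) = s by elim: s => //= ? ? ->.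
have copiesP s m : List.In m (copies s) -> List.In m moves.
  by case/List.in_map_iff => z [<- _]; apply: copy_move.
exists (copies (map Some u) ++ (map Some p.1, map Some p.2) ::
        copies (rcons (map Some v) None) ++ ms).
  move=> m /(List.in_app_or _ _ _) [/copiesP //|[<-|]]; first exact: rule_move.
  by case/(List.in_app_or _ _ _) => [/copiesP|/msP].
rewrite /alphas /betas !(map_cat, flatten_cat) /= !(map_cat, flatten_cat).
rewrite !acopies !bcopies -!catA cat_rcons -E !map_cat -!catA.
by rewrite cat_rcons.
Qed.

(** * The order of the items *)

Definition item_terms (s : seq item) : seq T := flatten (map item_term s).
Definition item_rows (s : seq item) : row := flatten (map item_row s).
Definition item_codes (s : seq item) := flatten (map item_code s).

Lemma item_cases i : List.In i items ->
  [\/ exists a, i = Term a, i = Start |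
      exists2 m, List.In m moves & i = Move m.1 m.2].
Proof.
case/(List.in_app_or _ _ _) => [/List.in_map_iff [a [<- _]]|[<-|]].
- by apply: Or31; exists a.
- exact: Or32.
by case/List.in_map_iff => m [<- mP]; apply: Or33; exists m.
Qed.

(** A spacer is pending, and [Term] or [Start] would put a second one next to it; only moves can
    follow. *)
Lemma items_after_start s w : (forall i, List.In i s -> List.In i items) ->
  None :: item_codes s = rcons (pre w) None ->
  exists2 ms, forall m, List.In m ms -> List.In m moves &
    [/\ w = alphas ms, item_terms s = [::] & item_rows s = betas ms].
Proof.
elim: s w => [|i s IHs] w sP.
  by case: w => // _; exists [::].
have {}IHs w' := IHs w' (fun i h => sP i (or_intror h)).
have [[a ->]|->|[m mP ->]] := item_cases (sP i (or_introl erefl)).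
- by case: w => [|x w] // [].
- by case: w => [|x w] // [].
rewrite /item_codes /= => E.
have {E} [w' -> E] : exists2 w', w = m.1 ++ w' &
    None :: item_codes s = rcons (pre w') None.
  elim: m.1 w E => [|x u IHu] [|z w] //= E.
  - by exists [::].
  - by exists (z :: w).
  - by case: E => -> /IHu [w' -> Ew']; exists w'.
have [ms msP [-> st sr]] := IHs _ E.
exists (m :: ms) => [m' [<-|/msP]//|].
by split=> //; rewrite [LHS]/(m.2 ++ item_rows s) sr.
Qed.

(* The alternation of spacers and letters forces all [Term] items to come
   first, followed by one [Start]. *)
Lemma items_sound s w : (forall i, List.In i s -> List.In i items) ->
  item_codes s = rcons (pre w) None ->
  exists2 ms, forall m, List.In m ms -> List.In m moves &
    w = map Some (map inl (item_terms s)) ++ None :: alphas ms /\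
    item_rows s = betas ms.
Proof.
elim: s w => [|i s IHs] w sP; first by case: w.
have {}IHs w' := IHs w' (fun i h => sP i (or_intror h)).
have sP' j : List.In j s -> List.In j items by move=> h; apply: sP; right.
have [[a ->]|->|[m mP ->]] := item_cases (sP i (or_introl erefl)).
- case: w => // x w [<- /IHs [ms msP [-> sr]]].
  by exists ms.
- case: w => // x w [<- /(items_after_start sP') [ms msP [-> st sr]]].
  by exists ms => //; rewrite (_ : item_terms (Start :: s) = [::]).
(* A [Move] begins with a letter where a spacer is due. *)
by case: m mP => [[|x u] v] /move_nonempty //; case: w.
Qed.

(** The earliest row, the start symbol, comes from no other row; it ends the left side, together
    with the last spacer. *)
Definition row_end : seq bool := codes (rcons (pre [:: Some start; None]) None).

Definition simulating_grammar : scm_grammar T :=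
  piece_grammar (map item_piece items) row_end.

Lemma map_pieces_ex ps :
  (forall p, List.In p ps -> List.In p (map item_piece items)) ->
  exists2 s, forall i, List.In i s -> List.In i items & ps = map item_piece s.
Proof.
elim: ps => [|p ps IHps] psP; first by exists [::].
have [s sP ->] := IHps (fun q h => psP q (or_intror h)).
have /List.in_map_iff [i [<- iP]] := psP p (or_introl erefl).
by exists (i :: s) => // j [<-|/sP].
Qed.

Definition get_inl (A B : Type) (x : A + B) : option A := if x is inl a then Some a else None.
Definition get_inr (A B : Type) (x : A + B) : option B := if x is inr b then Some b else None.

Lemma get_inl_inl (A B : Type) (u : seq A) : pmap (@get_inl A B) (map inl u) = u.
Proof. by elim: u => //= x u ->. Qed.

Lemma get_inl_inr (A B : Type) (v : seq B) : pmap (@get_inl A B) (map inr v) = [::].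
Proof. by elim: v. Qed.

Lemma get_inr_inl (A B : Type) (u : seq A) : pmap (@get_inr A B) (map inl u) = [::].
Proof. by elim: u. Qed.

Lemma get_inr_inr (A B : Type) (v : seq B) : pmap (@get_inr A B) (map inr v) = v.
Proof. by elim: v => //= x v ->. Qed.

Lemma rights_items s : rights (map item_piece s) = codes (item_codes s).
Proof.
by elim: s => //= i s; rewrite /rights /item_codes /= codes_cat => ->.
Qed.

Lemma lefts_items_inl s : pmap (@get_inl T bool) (lefts (map item_piece s)) = item_terms s.
Proof.
elim: s => //= i s; rewrite /lefts /item_terms /= !pmap_cat => ->.
by rewrite get_inl_inl get_inl_inr cats0.
Qed.

Lemma lefts_items_inr s :
  pmap (@get_inr T bool) (lefts (map item_piece s)) = codes (pre (item_rows s)).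
Proof.
elim: s => //= i s; rewrite /lefts /item_rows /= !pmap_cat pre_cat codes_cat => ->.
by rewrite get_inr_inl get_inr_inr.
Qed.

Lemma simulating_langP y : ps_lang G y <-> scm_lang simulating_grammar y.
Proof.
rewrite piece_langP; split=> [st|[ps psP]].
  have [|ms msP E] := moves_complete st; first by exists [::].
  pose s := map Term y ++ Start :: [seq Move m.1 m.2 | m <- ms].
  have sE : [/\ lefts (map item_piece s) = map inl y ++ map inr (codes (pre (betas ms)))
              & item_codes s = rcons (pre (map Some (map inl y) ++ None :: alphas ms)) None].
    rewrite /s /item_codes /lefts !map_cat !flatten_cat; split.
      congr (_ ++ _); first by elim: (y) => //= a u ->.
      elim: (ms) => //= m ms' IH.
      by rewrite IH [betas (m :: ms')]/(m.2 ++ betas ms') pre_cat codes_cat map_cat.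
    rewrite pre_cat rcons_cat; congr (_ ++ _); first by elim: (y) => //= a u ->.
    rewrite /= -pre_post; congr [:: _, _, _ & _].
    by elim: (ms) => //= m ms' ->; rewrite -post_cat.
  exists (map item_piece s).
    move=> p /List.in_map_iff [i [<- iP]]; apply: List.in_map; move: iP.
    case/(List.in_app_or _ _ _) => [/List.in_map_iff [a [<- _]]|[<-|]].
    - apply/List.in_or_app; left; apply: List.in_map.
      have := mem_enum T a; elim: (enum _) => // z e IHe.
      by rewrite inE => /orP[/eqP->|/IHe]; [left | right].
    - by apply/List.in_or_app; right; left.
    case/List.in_map_iff => m [<- mP]; apply/List.in_or_app; right; right.
    by apply: (List.in_map (fun m => Move m.1 m.2)); apply: msP.
  case: sE => -> cE; rewrite rights_items cE E -catA -map_cat; congr (_ ++ map _ _).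
  by rewrite /row_end -codes_cat pre_cat rcons_cat.
have [s sP ->] := map_pieces_ex psP; rewrite rights_items => E.
(* Terminals and bits of the equation are compared separately. *)
have termE := congr1 (pmap (@get_inl T bool)) E.
have codeE := congr1 (pmap (@get_inr T bool)) E.
rewrite !pmap_cat lefts_items_inl get_inl_inl !get_inl_inr !cats0 in termE.
rewrite !pmap_cat lefts_items_inr get_inr_inl !get_inr_inr /row_end -codes_cat in codeE.
move/codes_inj/esym: codeE; rewrite -rcons_cat -pre_cat => codeE.
have [ms msP [wE rowsE]] := items_sound sP codeE.
rewrite rowsE termE in wE.
exact: (moves_sound msP (v := [::]) (esym wE)).
Qed.

(** Four matrices are conditional: [unmark], [erase] and the two [mark], which are the non-simple
    ones. The degree comes from CCACCC and CAC. *)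
Lemma simulating_SCM (L : seq T -> Prop) :
  (forall y, L y <-> ps_lang G y) -> SCM 6 3 4 7 2 3 L.
Proof.
move=> LG; exists simulating_grammar; split; last first.
  by move=> y; rewrite LG; apply: simulating_langP.
have MP r : List.In r (scm_M simulating_grammar) ->
  matrix_wf r /\ cond_size (mP r) <= 6 /\ cond_size (mF r) <= 3 /\ size (mrules r) <= 2.
  case/(List.in_app_or _ _ _) => [/List.in_map_iff [p [<- _]]|].
    by split=> //; split=> //; split.
  by do 5![case=> [<-|]; first by split=> //; split=> //; split=> w // [<-]].
have uncond (a : pred _) ps : (forall w, a (spawn w) = false) ->
    count a (map (@piece_matrix T) ps) = 0.
  by move=> aw; elim: ps => //= p ps ->; rewrite aw.
split; [by move=> r /MP[] | by move=> r /MP[_]| | |].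
- by rewrite !card_option card_bool.
- by rewrite count_cat uncond.
- by rewrite count_cat uncond.
Qed.

End FromPhraseStructure.

(** * Phrase-structure grammars with a head *)

Section HeadMachine.
Variables (T D : finType) (Q : choiceType) (q0 : Q).
Local Notation tape := (sym T D).
Definition config : Type := (seq tape * option Q * seq tape)%type.
Variable rules : seq (seq tape * Q * seq tape * (seq tape * option Q * seq tape)).

Inductive hstep : config -> config -> Prop :=
  HStep u v a q b a' o b' : (a, q, b, (a', o, b')) \in rules ->
    hstep (u ++ a, Some q, b ++ v) (u ++ a', o, b' ++ v).

(** The type of states may be infinite; only the initial state and those in rules become
    nonterminals. *)
Definition heads : seq Q :=
  q0 :: flatten [seq r.1.1.2 :: (if r.2.1.2 is Some q then [:: q] else [::]) | r <- rules].

(** Other states are sent to the default [q0], so this is injective on [heads] only. *)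
Definition head_of (q : Q) : seq_sub heads := insubd (SeqSub (mem_head q0 _)) q.

Lemma head_of_inj : {in heads &, injective head_of}.
Proof. by move=> q q' hq hq' /(congr1 val); rewrite !val_insubd hq hq'. Qed.

Lemma rule_heads a q b a' o b' : (a, q, b, (a', o, b')) \in rules ->
  q \in heads /\ (forall q', o = Some q' -> q' \in heads).
Proof.
move=> rP; split=> [|q' oE]; rewrite inE; apply/orP; right; apply/flatten_mapP.
  by exists (a, q, b, (a', o, b')); rewrite // inE eqxx.
by exists (a, q, b, (a', o, b')); rewrite // oE !inE eqxx orbT.
Qed.

Local Notation W := (sym T (D + seq_sub heads)%type).

Definition emb_tape (x : tape) : W :=
  match x with inl t => inl t | inr d => inr (inl d) end.

Definition emb_config (c : config) : seq W :=
  map emb_tape c.1.1 ++ (if c.1.2 is Some q then [:: inr (inr (head_of q))] else [::])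
    ++ map emb_tape c.2.

Definition machine_grammar : ps_grammar T :=
  @PSGrammar T (D + seq_sub heads)%type (inr (head_of q0))
    [seq (emb_config (r.1.1.1, Some r.1.1.2, r.1.2), emb_config r.2) | r <- rules].

Lemma machine_wf : ps_wf machine_grammar.
Proof.
move=> _ /mapP[r _ ->] /=; exists (inr (head_of r.1.1.2)).
by rewrite /emb_config /= mem_cat inE eqxx orbT.
Qed.

Lemma emb_tape_inj : injective emb_tape.
Proof. by move=> [t|d] [t'|d'] // [->]. Qed.

Lemma head_notin q s : inr (inr q) \notin map emb_tape s.
Proof. by apply/negP => /mapP[[t|d]]. Qed.

Lemma map_tape_cat (u a : seq W) (s : seq tape) : u ++ a = map emb_tape s ->
  exists u' a', [/\ s = u' ++ a', u = map emb_tape u' & a = map emb_tape a'].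
Proof.
elim: u s => [|x u IHu] s /=; first by move=> ->; exists [::], s.
by case: s => //= y s [-> /IHu [u' [a' [-> -> ->]]]]; exists (y :: u'), a'.
Qed.

Lemma hstep_ps c c' : hstep c c' -> ps_step (G := machine_grammar) (emb_config c) (emb_config c').
Proof.
case=> u v a q b a' o b' rP.
exists (emb_config (a, Some q, b), emb_config (a', o, b')), (map emb_tape u), (map emb_tape v).
split; first by apply/mapP; exists (a, q, b, (a', o, b')).
  by rewrite /emb_config /= !map_cat -!catA.
by rewrite /emb_config /= !map_cat -!catA.
Qed.

Definition known (c : config) : Prop := forall q, c.1.2 = Some q -> q \in heads.

(** An encoded configuration has at most one head, so a left-hand side fits only around it. *)
Lemma ps_hstep c s : known c -> ps_step (G := machine_grammar) (emb_config c) s ->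
  exists c', [/\ known c', hstep c c' & s = emb_config c'].
Proof.
case: c => -[p o] s0 kc [_ [u [v [/mapP[[[[a q] b] [[a' o'] b']] rP ->] cE ->]]]].
have [qh o'h] := rule_heads rP.
case: o kc cE => [q'|] kc; rewrite /emb_config /= -?catA /=; last first.
  rewrite -map_cat => E; have := head_notin (head_of q) (p ++ s0).
  by rewrite E !mem_cat inE eqxx !orbT.
have q'h : q' \in heads by apply: kc.
move: (head_of q) (head_of q') (@head_of_inj _ _ qh q'h) => h h' hh' E.
have hE : h = h'.
  have : inr (inr h) \in map emb_tape p ++ inr (inr h') :: map emb_tape s0.
    by rewrite E !mem_cat inE eqxx !orbT.
  rewrite mem_cat inE (negPf (head_notin _ _)) (negPf (head_notin _ _)) orbF.
  by case/eqP=> ->.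
move: (hh' hE) => qq'; subst h' q'.
have := @cat_cons_split _ (inr (inr h)) (u ++ map emb_tape a) (map emb_tape b ++ v) _ _
  (head_notin h p).
rewrite -catA => /(_ (map emb_tape s0) (esym E)) [[pE sE]|[x [_ sE]]]; last first.
  by have := head_notin h s0; rewrite sE mem_cat inE eqxx orbT.
have [u' [a0 [-> -> /(inj_map emb_tape_inj) <-]]] := map_tape_cat pE.
have [b0 [v' [-> /(inj_map emb_tape_inj) <- ->]]] := map_tape_cat sE.
exists (u' ++ a', o', b' ++ v'); split; first by move=> q'; apply: o'h.
  exact: HStep.
by rewrite /emb_config /= !map_cat -!catA.
Qed.

Lemma star_ps_hstep s t : star (ps_step (G := machine_grammar)) s t ->
  forall c, known c -> s = emb_config c -> exists2 c', star hstep c c' & t = emb_config c'.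
Proof.
elim=> [{}s|{}s s1 {}t ss1 _ IH] c kc sE; first by exists c => //; apply: star_refl.
rewrite sE in ss1; have [c1 [kc1 cc1 s1E]] := ps_hstep kc ss1.
have [c' c1c' tE] := IH c1 kc1 s1E; exists c' => //.
exact: star_step cc1 c1c'.
Qed.

Lemma star_hstep_ps c c' : star hstep c c' ->
  star (ps_step (G := machine_grammar)) (emb_config c) (emb_config c').
Proof.
elim=> [{}c|{}c c1 {}c' /hstep_ps cc1 _]; first exact: star_refl.
exact: star_step.
Qed.

Theorem machine_langP y : ps_lang machine_grammar y <->
  exists a b, star hstep ([::], Some q0, [::]) (a, None, b) /\ a ++ b = map inl y.
Proof.
split=> [st|[a [b [st E]]]].
  have [|//|[[a o] b] st' yE] := star_ps_hstep st (c := ([::], Some q0, [::])).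
    by move=> q [<-]; apply: mem_head.
  case: o st' yE => [q|] st'; rewrite /emb_config /= => yE.
    have : inr (inr (head_of q)) \in (map inl y : seq W).
      by rewrite yE mem_cat inE eqxx orbT.
    by case/mapP.
  exists a, b; split=> //; apply: (inj_map emb_tape_inj).
  by rewrite map_cat -yE -map_comp.
have := star_hstep_ps st; rewrite /emb_config /= -map_cat E -map_comp.
exact.
Qed.

End HeadMachine.


(** * Executing matrices *)

Section FromSemiConditional.
Variables (T : finType) (G : scm_grammar T).
Local Notation N := (scm_N G).
Local Notation V := (sym T N).
Local Notation step := (gstep (scm_M G)).
Local Notation reach := (star step [:: inr (scm_S G)]).

(** * Matrices as programs of single instructions *)

Local Notation instr := ((seq V + seq V) + N * seq V)%type.
Local Notation need w := (inl (inl w) : instr).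
Local Notation avoid w := (inl (inr w) : instr).

Definition istep (i : instr) (x y : seq V) : Prop :=
  match i with
  | inl (inl w) => infix w x /\ x = y
  | inl (inr w) => ~~ infix w x /\ x = y
  | inr (A, w) => rewrite1 A w x y
  end.

Fixpoint exec (p : seq instr) (x y : seq V) : Prop :=
  if p is i :: p' then exists z, istep i x z /\ exec p' z y else x = y.

(** Tests come first, because both conditions of a matrix concern the word before any rewriting. *)
Definition prog (r : matrix T N) : seq instr :=
  (if mP r is Some w then [:: need w] else [::]) ++
  (if mF r is Some w then [:: avoid w] else [::]) ++ map inr (mrules r).

Lemma exec_prog r x y : exec (prog r) x y <-> mstep r x y.
Proof.
have execR rs z : exec (map inr rs) z y <-> apply_rules rs z y.
  elim: rs z => // -[A w] rs IHrs z; split=> -[z' [zz' /IHrs]]; by exists z'.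
rewrite /prog /mstep; case: (mP r) => [P|]; case: (mF r) => [F|] /=.
- split=> [[_ [[hP <-] [_ [[hF <-] /execR]]]]|[hP [hF /execR]]].
    by split=> [_ [<-]|] //; split=> [_ [<-]|].
  by exists x; split; [split=> //; apply: hP | exists x; split=> //; split=> //; apply: hF].
- split=> [[_ [[hP <-] /execR]]|[hP [hF /execR]]].
    by split=> [_ [<-]|] //; split.
  by exists x; split=> //; split=> //; apply: hP.
- split=> [[_ [[hF <-] /execR]]|[hP [hF /execR]]].
    by split=> //; split=> [_ [<-]|].
  by exists x; split=> //; split=> //; apply: hF.
- by split=> [/execR|[_ [_ /execR]]].
Qed.

(** * The rules of the machine *)

Local Notation tape := (sym T (N + bool)%type).
Local Notation state := (nat + seq instr * bool)%type.
Local Notation L := (inr (inr true) : tape).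
Local Notation R := (inr (inr false) : tape).
Local Notation init := (inl 0 : state).
Local Notation idle := (inl 1 : state).
Local Notation leave := (inl 2 : state).
(* [go p] scans to the right in order to execute the first instruction of [p],
   [back p] returns to the left end after having executed it. *)
Local Notation go p := (inr (p, true) : state).
Local Notation back p := (inr (p, false) : state).
Local Notation rule := (seq tape * state * seq tape * (seq tape * option state * seq tape))%type.

Definition tv (x : V) : tape := match x with inl t => inl t | inr A => inr (inl A) end.

Fixpoint words (n : nat) : seq (seq V) :=
  if n is n'.+1 then [seq x :: z | x <- enum {: V}, z <- words n'] else [:: [::]].

Lemma mem_words z n : (z \in words n) = (size z == n).
Proof.
elim: n z => [|n IHn] z /=; first by rewrite inE size_eq0.
apply/allpairsP/eqP => [[[x u] [_ /=]]|]; first by rewrite IHn => /eqP<- ->.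
case: z => // x z [zn]; exists (x, z); split=> //; first by rewrite mem_enum.
by rewrite IHn /= zn.
Qed.

Definition go_right (p : seq instr) : seq rule :=
  [seq ([::], go p, [:: tv x], ([:: tv x], Some (go p), [::])) | x <- enum {: V}].

(* The head passes a letter only if [w] does not start there. *)
Definition pass_window (p : seq instr) (w : seq V) : seq rule :=
  [seq ([::], go p, map tv z, (map tv (take 1 z), Some (go p), map tv (behead z)))
     | z <- words (size w) & z != w].

(** Reading as far as the right marker shows that fewer than [size w] letters remain, so no
    occurrence of [w] starts here or later. *)
Definition pass_end (p : seq instr) (w : seq V) : seq rule :=
  [seq ([::], go p, rcons (map tv z) R, ([::], Some (back p), rcons (map tv z) R))
     | z <- flatten [seq words k | k <- iota 0 (size w)]].

Definition go_back (p : seq instr) : seq rule :=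
  [seq ([:: tv x], back p, [::], ([::], Some (back p), [:: tv x])) | x <- enum {: V}].

Definition instr_rules (i : instr) (p : seq instr) : seq rule :=
  match i with
  | inl (inl w) => ([::], go p, map tv w, ([::], Some (back p), map tv w)) :: go_right p
  | inl (inr w) => pass_window p w ++ pass_end p w
  | inr (A, w) =>
    ([::], go p, [:: tv (inr A)], ([::], Some (back p), map tv w)) :: go_right p
  end.

Definition prog_rules (p : seq instr) : seq rule :=
  if p is i :: p' then
    instr_rules i p ++
    ([:: L], back p, [::], ([:: L], Some (go p'), [::])) :: go_back p
  else [:: ([:: L], go [::], [::], ([:: L], Some idle, [::]))].

Fixpoint tails (p : seq instr) : seq (seq instr) :=
  p :: (if p is _ :: p' then tails p' else [::]).

Definition progs : seq (seq instr) := flatten [seq tails p | p <- map prog (scm_M G)].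

(** The machine may leave with any word: nonterminals in it remain nonterminals of the machine, so
    terminality need not be checked. *)
Definition main_rules : seq rule :=
  [:: ([::], init, [::], ([:: L], Some idle, [:: tv (inr (scm_S G)); R]));
      ([:: L], idle, [::], ([::], Some leave, [::]));
      ([::], leave, [:: R], ([::], None, [::]))] ++
  [seq ([::], leave, [:: tv x], ([:: tv x], Some leave, [::])) | x <- enum {: V}].

Definition dispatch_rules : seq rule :=
  [seq ([::], idle, [::], ([::], Some (go (prog r)), [::])) | r <- scm_M G].

Definition scm_rules : seq rule :=
  main_rules ++ dispatch_rules ++ flatten [seq prog_rules p | p <- progs].

Local Notation hstep := (hstep scm_rules).

(** * Runs of the machine are derivations *)

Lemma tv_inj : injective tv.
Proof. by move=> [t|d] [t'|d'] // [->]. Qed.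

Lemma right_notin s : R \notin map tv s.
Proof. by apply/negP => /mapP[[t|A]]. Qed.

Lemma tape_prefix w v s : map tv w ++ s = map tv v ++ [:: R] ->
  exists2 v', v = w ++ v' & s = map tv v' ++ [:: R].
Proof.
elim: w v => [|x w IHw] v /=; first by move=> ->; exists v.
case: v => [|y v] /=; first by case: x => [t|A] [].
by case=> /tv_inj -> /IHw [v' -> ->]; exists v'.
Qed.

Lemma tape_end z v s : rcons (map tv z) R ++ s = map tv v ++ [:: R] ->
  z = v /\ s = [::].
Proof.
rewrite cat_rcons => /esym.
case/(cat_cons_split (right_notin z)) => [[/(inj_map tv_inj)-> <-] //|].
case=> q [vE _]; have := right_notin v.
by rewrite vE mem_cat inE eqxx orbT.
Qed.

Lemma tape_back u x s : s ++ [:: tv x] = L :: map tv u ->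
  exists2 u', u = rcons u' x & s = L :: map tv u'.
Proof.
case/lastP: u => [|u y]; first by case: s => [|z [|? ?]] //; case: x => [t|A] [].
rewrite cats1 map_rcons -rcons_cons => /rcons_inj[-> /tv_inj->].
by exists u.
Qed.

Lemma tape_left u s : s ++ [:: L] = L :: map tv u -> s = [::] /\ u = [::].
Proof.
case/lastP: u => [|u y]; first by case: s => [|z [|? ?]].
by rewrite cats1 map_rcons -rcons_cons => /rcons_inj[_]; case: y.
Qed.

(** Within a matrix only the outcomes of the remaining program are claimed reachable, so a run that
    gets stuck claims nothing. The last clause for [go] says that no occurrence of the forbidden
    factor begins before the head. *)
Definition inv (c : config T (N + bool)%type state) : Prop :=
  let: (l, o, s) := c in
  match o with
  | None => exists u v, [/\ l = map tv u, s = map tv v & reach (u ++ v)]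
  | Some (inl 0) => l = [::] /\ s = [::]
  | Some (inl 1) => exists x, [/\ l = [:: L], s = map tv x ++ [:: R] & reach x]
  | Some (inl _) =>
    exists u v, [/\ l = map tv u, s = map tv v ++ [:: R] & reach (u ++ v)]
  | Some (inr (p, true)) =>
    exists u v, [/\ l = L :: map tv u, s = map tv v ++ [:: R],
      forall y, exec p (u ++ v) y -> reach y &
      forall w p', p = avoid w :: p' ->
        forall a b, u ++ v = a ++ w ++ b -> size u <= size a]
  | Some (inr (p, false)) =>
    exists u v, [/\ l = L :: map tv u, s = map tv v ++ [:: R] &
      forall y, exec (behead p) (u ++ v) y -> reach y]
  end.

Lemma main_rules_inv l a q b s a' o b' :
  (a, q, b, (a', o, b')) \in main_rules ->
  inv (l ++ a, Some q, b ++ s) -> inv (l ++ a', o, b' ++ s).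
Proof.
rewrite mem_cat !inE -!orbA => /or4P[/eqP[-> -> -> -> -> ->]|/eqP[-> -> -> -> -> ->]
  |/eqP[-> -> -> -> -> ->]|/mapP[x _ [-> -> -> -> -> ->]]] /=.
- rewrite cats0 => -[-> ->]; exists [:: inr (scm_S G)]; split=> //.
  exact: star_refl.
- case=> x [/(tape_left (u := [::]))[-> _] -> rx].
  by exists [::], x.
- case=> u [v [-> /(tape_end (z := [::]))[<- ->] ruv]].
  by exists u, [::].
rewrite cats0 => -[u [v [-> /(tape_prefix (w := [:: x])) [v' -> ->] ruv]]].
by exists (u ++ [:: x]), v'; rewrite map_cat -catA.
Qed.

Lemma exec_reach x r y : reach x -> List.In r (scm_M G) -> exec (prog r) x y -> reach y.
Proof.
move=> rx rM /exec_prog xy; apply: star_trans rx (star_one _); by exists r.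
Qed.

Lemma dispatch_rules_inv l a q b s a' o b' :
  (a, q, b, (a', o, b')) \in dispatch_rules ->
  inv (l ++ a, Some q, b ++ s) -> inv (l ++ a', o, b' ++ s).
Proof.
move=> h; have [r [rM [-> -> -> -> -> ->]]] : exists r, List.In r (scm_M G) /\
    (a, q, b, (a', o, b')) = ([::], idle, [::], ([::], Some (go (prog r)), [::])).
  move: h; rewrite /dispatch_rules; elim: (scm_M G) => //= r M IHM.
  rewrite inE => /orP[/eqP->|/IHM [r' [r'M ->]]]; first by exists r; split; [left|].
  by exists r'; split; [right|].
rewrite /= cats0 => -[x [-> -> rx]]; exists [::], x; split=> // y.
exact: exec_reach.
Qed.

Lemma go_right_inv i p l a q b s a' o b' :
  (forall w, i <> avoid w) ->
  (a, q, b, (a', o, b')) \in go_right (i :: p) ->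
  inv (l ++ a, Some q, b ++ s) -> inv (l ++ a', o, b' ++ s).
Proof.
move=> iA /mapP[x _ [-> -> -> -> -> ->]] /=; rewrite cats0.
case=> u [v [-> /(tape_prefix (w := [:: x])) [v' -> ->] uv _]].
exists (rcons u x), v'; split=> //.
- by rewrite map_rcons -cats1.
- by move=> y; rewrite cat_rcons; apply: uv.
by move=> w p' [/iA].
Qed.

Lemma pass_window_inv w p l a q b s a' o b' :
  (a, q, b, (a', o, b')) \in pass_window (avoid w :: p) w ->
  inv (l ++ a, Some q, b ++ s) -> inv (l ++ a', o, b' ++ s).
Proof.
move=> /mapP[z]; rewrite mem_filter mem_words => /andP[zw /eqP size_z].
case=> -> -> -> -> -> -> /=; rewrite cats0.
case=> u [v [-> /tape_prefix [v' -> ->] uv /(_ _ _ erefl) occ]].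
case: z zw size_z uv occ => [|x z] zw size_z uv occ.
  by move: zw; rewrite eq_sym -size_eq0 -size_z.
exists (rcons u x), (z ++ v'); split.
- by rewrite map_rcons -cats1 /= take0.
- by rewrite map_cat catA.
- by move=> y; rewrite cat_rcons; apply: uv.
move=> w' p' [<- _] c d E; rewrite size_rcons ltn_neqAle.
have E' : u ++ (x :: z) ++ v' = c ++ w ++ d by rewrite -E cat_rcons.
(* An occurrence starting exactly at the head would equal the window [x :: z]. *)
rewrite (occ _ _ E') andbT; apply: contraNneq zw => uc.
have /andP[_] : (u == c) && ((x :: z) ++ v' == w ++ d) by rewrite -eqseq_cat ?E'.
by rewrite eqseq_cat // => /andP[].
Qed.

Lemma pass_end_inv w p l a q b s a' o b' :
  (a, q, b, (a', o, b')) \in pass_end (avoid w :: p) w ->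
  inv (l ++ a, Some q, b ++ s) -> inv (l ++ a', o, b' ++ s).
Proof.
move=> /mapP[z /flatten_mapP[k]]; rewrite mem_iota mem_words => /andP[_ kw] /eqP zk.
case=> -> -> -> -> -> -> /=; rewrite cats0.
case=> u [v [-> E uv /(_ _ _ erefl) occ]]; exists u, v; split=> // y uvy.
apply: uv; exists (u ++ v); split=> //; split=> //; apply/negP => /infixP[c [d cwd]].
have [zv _] := tape_end E.
(* An occurrence would start at the head or later, where fewer than [size w] letters remain. *)
have := congr1 size cwd; rewrite !size_cat -zv zk => sizes.
have := occ _ _ cwd; move: kw; rewrite add0n => kw uc.
have := leq_add uc (leq_trans kw (leq_addr (size d) _)).
by rewrite -sizes addnS ltnn.
Qed.

Lemma prog_rules_inv p l a q b s a' o b' :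
  (a, q, b, (a', o, b')) \in prog_rules p ->
  inv (l ++ a, Some q, b ++ s) -> inv (l ++ a', o, b' ++ s).
Proof.
case: p => [|i p].
  rewrite inE => /eqP[-> -> -> -> -> ->] /= [u [v [/tape_left[-> ->] -> uv _]]].
  by exists v; split=> //; apply: uv.
rewrite mem_cat inE => /or3P[|/eqP[-> -> -> -> -> ->]|/mapP[x _ [-> -> -> -> -> ->]]] /=.
- case: i => [[w|w]|[A w]] /=.
  + rewrite inE => /orP[/eqP[-> -> -> -> -> ->]|]; last exact: go_right_inv.
    rewrite /= cats0 => -[u [v [-> E uv _]]]; exists u, v; split=> // y uvy.
    have [v' vE _] := tape_prefix E.
    by apply: uv; exists (u ++ v); split=> //; split=> //; apply/infixP; exists u, v'; rewrite vE.
  + by rewrite mem_cat => /orP[]; [apply: pass_window_inv | apply: pass_end_inv].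
  rewrite inE => /orP[/eqP[-> -> -> -> -> ->]|]; last exact: go_right_inv.
  rewrite /= cats0 => -[u [v [-> /(tape_prefix (w := [:: inr A])) [v' -> ->] uv _]]].
  exists u, (w ++ v'); split=> //; first by rewrite map_cat catA.
  move=> y uvy; apply: uv; exists (u ++ w ++ v'); split=> //.
  by exists u, v'.
- case=> u [v [/tape_left[-> ->] -> uv]]; exists [::], v; split=> //.
case=> u [v [/tape_back[u' -> ->] -> uv]]; exists u', (x :: v); split=> //.
- by rewrite cats0.
by rewrite -cat_rcons.
Qed.

Lemma hstep_inv c c' : hstep c c' -> inv c -> inv c'.
Proof.
case=> u v a q b a' o b'.
rewrite /scm_rules mem_cat => /orP[|]; first exact: main_rules_inv.
rewrite mem_cat => /orP[|/flatten_mapP[p _]]; first exact: dispatch_rules_inv.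
exact: prog_rules_inv.
Qed.

Lemma star_inv c c' : star hstep c c' -> inv c -> inv c'.
Proof. by elim=> // {}c c1 {}c' /hstep_inv cc1 _ IH /cc1. Qed.

(** * Derivations are runs of the machine *)

Lemma prog_rules_in p r : p \in progs -> r \in prog_rules p -> r \in scm_rules.
Proof.
move=> pP rp; rewrite /scm_rules mem_cat; apply/orP; right.
by rewrite mem_cat; apply/orP; right; apply/flatten_mapP; exists p.
Qed.

Lemma tails_tail i p p' : i :: p \in tails p' -> p \in tails p'.
Proof.
elim: p' => [|j p' IHp] //=; rewrite !inE => /orP[/eqP[_ ->]|/IHp->]; last exact: orbT.
by case: (p') => *; rewrite mem_head orbT.
Qed.

Lemma progs_tail i p : i :: p \in progs -> p \in progs.
Proof. by case/flatten_mapP=> r rM /tails_tail pr; apply/flatten_mapP; exists r. Qed.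

Lemma star_go_right i p u v w : i :: p \in progs -> (forall w, i <> avoid w) ->
  star hstep (L :: map tv u, Some (go (i :: p)), map tv (v ++ w) ++ [:: R])
             (L :: map tv (u ++ v), Some (go (i :: p)), map tv w ++ [:: R]).
Proof.
move=> pP iA; elim: v u => [|x v IHv] u; first by rewrite cats0; apply: star_refl.
rewrite -[u ++ x :: v]cat_rcons; apply: (star_step _ (IHv _)).
have := @HStep _ _ _ scm_rules (L :: map tv u) (map tv (v ++ w) ++ [:: R])
  [::] (go (i :: p)) [:: tv x] [:: tv x] (Some (go (i :: p))) [::].
rewrite cats0 /= map_rcons -cats1; apply.
apply: prog_rules_in pP _; rewrite /= mem_cat; apply/orP; left.
have h : ([::], go (i :: p), [:: tv x], ([:: tv x], Some (go (i :: p)), [::]))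
    \in go_right (i :: p) by apply/mapP; exists x; rewrite ?mem_enum.
by case: i iA {IHv} h => [[w'|w']|[A w']] iA h; rewrite /= ?inE ?h ?orbT //; case: (iA w').
Qed.

Lemma star_go_back i p u v : i :: p \in progs ->
  star hstep (L :: map tv u, Some (back (i :: p)), map tv v ++ [:: R])
             ([:: L], Some (go p), map tv (u ++ v) ++ [:: R]).
Proof.
move=> pP; elim/last_ind: u v => [|u x IHu] v.
  apply: star_one.
  have := @HStep _ _ _ scm_rules [::] (map tv v ++ [:: R])
    [:: L] (back (i :: p)) [::] [:: L] (Some (go p)) [::].
  by apply; apply: prog_rules_in pP _; rewrite /= mem_cat inE eqxx orbT.
rewrite cat_rcons; apply: (star_step _ (IHu _)).
have := @HStep _ _ _ scm_rules (L :: map tv u) (map tv v ++ [:: R])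
  [:: tv x] (back (i :: p)) [::] [::] (Some (back (i :: p))) [:: tv x].
rewrite cats0 /= map_rcons -cats1; apply.
apply: prog_rules_in pP _; rewrite /= mem_cat inE; apply/or3P; apply: Or33.
by apply/mapP; exists x; rewrite ?mem_enum.
Qed.

(** Every window differs from [w], which is not a factor; so the head advances until fewer than
    [size w] letters remain. *)
Lemma star_avoid w p u v : avoid w :: p \in progs -> ~~ infix w (u ++ v) ->
  exists u' v', u ++ v = u' ++ v' /\
  star hstep (L :: map tv u, Some (go (avoid w :: p)), map tv v ++ [:: R])
             (L :: map tv u', Some (back (avoid w :: p)), map tv v' ++ [:: R]).
Proof.
move=> pP Fuv.
have short a b : size b < size w ->
    hstep (L :: map tv a, Some (go (avoid w :: p)), map tv b ++ [:: R])
          (L :: map tv a, Some (back (avoid w :: p)), map tv b ++ [:: R]).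
  move=> bw; have := @HStep _ _ _ scm_rules (L :: map tv a) [::]
    [::] (go (avoid w :: p)) (rcons (map tv b) R) [::]
    (Some (back (avoid w :: p))) (rcons (map tv b) R).
  rewrite !cats0 -cats1; apply; apply: prog_rules_in pP _.
  rewrite /= mem_cat mem_cat; apply/orP; left; apply/orP; right.
  apply/mapP; exists b; last by rewrite cats1.
  by apply/flatten_mapP; exists (size b); rewrite ?mem_iota ?mem_words.
elim: v u Fuv => [|x v IHv] u Fuv.
  exists u, [::]; split=> //; apply/star_one/short.
  by case: (w) Fuv => // /negP[]; apply/infixP; exists [::], u; rewrite cats0.
have [wv|vw] := leqP (size w) (size (x :: v)); last first.
  by exists u, (x :: v); split=> //; apply/star_one/short.
have zw : take (size w) (x :: v) != w.
  apply: contraNneq Fuv => zw; apply/infixP; exists u, (drop (size w) (x :: v)).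
  by rewrite -{1}zw cat_take_drop.
(* An empty [w] would equal its window; from here on [w] denotes the tail. *)
case: w => [|y w] in pP zw wv Fuv short IHv *; first by rewrite take0 in zw.
have [|u' [v' [E st]]] := IHv (rcons u x); first by rewrite cat_rcons.
exists u', v'; split; first by rewrite -E cat_rcons.
apply: (star_step _ st).
(* The window without its first letter [x]. *)
set z := take (size w) v.
have vE : map tv v ++ [:: R] = map tv z ++ (map tv (drop (size w) v) ++ [:: R]).
  by rewrite catA -map_cat cat_take_drop.
have xvE : map tv (x :: v) ++ [:: R] =
    map tv (x :: z) ++ (map tv (drop (size w) v) ++ [:: R]) by rewrite /= vE.
have := @HStep _ _ _ scm_rules (L :: map tv u) (map tv (drop (size w) v) ++ [:: R])
  [::] (go (avoid (y :: w) :: p)) (map tv (x :: z)) [:: tv x]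
  (Some (go (avoid (y :: w) :: p))) (map tv z).
rewrite cats0 -xvE -vE map_rcons -cats1; apply.
apply: prog_rules_in pP _; rewrite /= mem_cat mem_cat; apply/orP; left.
apply/orP; left; apply/mapP; exists (x :: z); last by rewrite /= take0.
by rewrite mem_filter zw (mem_words _ (size w).+1) /= size_takel.
Qed.

Lemma star_istep i p x y : i :: p \in progs -> istep i x y ->
  star hstep ([:: L], Some (go (i :: p)), map tv x ++ [:: R])
             ([:: L], Some (go p), map tv y ++ [:: R]).
Proof.
move=> pP; case: i pP => [[w|w]|[A w]] pP /=.
- case=> /infixP[u [v ->]] <-.
  apply: star_trans (@star_go_right _ p [::] u (w ++ v) pP _) _ => //=.
  apply: (star_step _ (star_go_back u (w ++ v) pP)).
  have := @HStep _ _ _ scm_rules (L :: map tv u) (map tv v ++ [:: R])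
    [::] (go (need w :: p)) (map tv w) [::] (Some (back (need w :: p))) (map tv w).
  rewrite cats0 map_cat -!catA; apply; apply: prog_rules_in pP _.
  by rewrite /= inE eqxx.
- case=> Fx <-; have [u [v [xE st]]] := @star_avoid w p [::] x pP Fx.
  apply: star_trans st _; rewrite -[x]/([::] ++ x) xE; exact: star_go_back.
case=> u [v [-> ->]].
apply: star_trans (@star_go_right _ p [::] u (inr A :: v) pP _) _ => //=.
apply: (star_step _ (star_go_back u (w ++ v) pP)).
have := @HStep _ _ _ scm_rules (L :: map tv u) (map tv v ++ [:: R])
  [::] (go (inr (A, w) :: p)) [:: tv (inr A)] [::] (Some (back (inr (A, w) :: p))) (map tv w).
rewrite cats0 map_cat -!catA; apply; apply: prog_rules_in pP _.
by rewrite /= inE eqxx.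
Qed.

Lemma star_exec p x y : p \in progs -> exec p x y ->
  star hstep ([:: L], Some (go p), map tv x ++ [:: R])
             ([:: L], Some idle, map tv y ++ [:: R]).
Proof.
elim: p x => [|i p IHp] x pP /=.
  move=> <-; apply: star_one.
  apply: (@HStep _ _ _ scm_rules [::] (map tv x ++ [:: R])
    [:: L] (go [::]) [::] [:: L] (Some idle) [::]).
  by apply: prog_rules_in pP _; rewrite inE.
case=> z [/(star_istep pP) st /(IHp _ (progs_tail pP))].
exact: star_trans.
Qed.

Lemma star_gstep x y : star step x y ->
  star hstep ([:: L], Some idle, map tv x ++ [:: R])
             ([:: L], Some idle, map tv y ++ [:: R]).
Proof.
elim=> [{}x|{}x z {}y [r rM /exec_prog xz] _ IH]; first exact: star_refl.
apply: star_trans IH.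
have rP : prog r \in map prog (scm_M G).
  elim: (scm_M G) rM => //= r' M IHM [->|/IHM rM]; first exact: mem_head.
  by rewrite inE rM orbT.
have pP : prog r \in progs.
  by apply/flatten_mapP; exists (prog r); rewrite //; case: (prog r) => *; apply: mem_head.
apply: star_trans (star_exec pP xz).
apply: star_one.
have := @HStep _ _ _ scm_rules [:: L] (map tv x ++ [:: R])
  [::] idle [::] [::] (Some (go (prog r))) [::].
rewrite cats0; apply; rewrite /scm_rules mem_cat; apply/orP; right.
rewrite mem_cat; apply/orP; left.
(* Programs, unlike matrices, form an [eqType], which gives access to boolean membership. *)
have -> : dispatch_rules =
    [seq ([::], idle, [::], ([::], Some (go p), [::])) | p <- map prog (scm_M G)].
  by rewrite /dispatch_rules -map_comp.
by apply/mapP; exists (prog r).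
Qed.

Lemma star_leave u v :
  star hstep (map tv u, Some leave, map tv v ++ [:: R]) (map tv (u ++ v), None, [::]).
Proof.
elim: v u => [|x v IHv] u.
  rewrite cats0; apply: star_one.
  have := @HStep _ _ _ scm_rules (map tv u) [::] [::] leave [:: R] [::] None [::].
  by rewrite !cats0; apply; rewrite /scm_rules mem_cat /main_rules mem_cat !inE eqxx !orbT.
rewrite -[u ++ x :: v]cat_rcons; apply: (star_step _ (IHv _)).
have := @HStep _ _ _ scm_rules (map tv u) (map tv v ++ [:: R])
  [::] leave [:: tv x] [:: tv x] (Some leave) [::].
rewrite cats0 map_rcons -cats1; apply; rewrite /scm_rules mem_cat; apply/orP; left.
rewrite mem_cat; apply/orP; right.
by apply/mapP; exists x; rewrite ?mem_enum.
Qed.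

Lemma scm_machineP y : ps_lang (machine_grammar init scm_rules) y <-> scm_lang G y.
Proof.
rewrite machine_langP; split=> [[a [b [st abE]]]|].
  have := star_inv st; rewrite /= => -[//|u [v [aE bE ruv]]].
  suff uvE : u ++ v = map inl y by rewrite uvE in ruv.
  by apply: (inj_map tv_inj); rewrite map_cat -aE -bE abE -map_comp.
move/star_gstep => st; exists (map tv (map inl y)), [::].
split; last by rewrite cats0 -map_comp.
apply: star_step (_ : hstep _ ([:: L], Some idle, map tv [:: inr (scm_S G)] ++ [:: R])) _.
  apply: (@HStep _ _ _ scm_rules [::] [::] [::] init [::] [:: L] (Some idle)
    [:: tv (inr (scm_S G)); R]).
  by rewrite /scm_rules mem_cat /main_rules mem_cat !inE eqxx.
apply: star_trans st _; apply: (star_step _ (star_leave [::] _)).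
apply: (@HStep _ _ _ scm_rules [::] (_ ++ [:: R]) [:: L] idle [::] [::] (Some leave) [::]).
by rewrite /scm_rules mem_cat /main_rules mem_cat !inE eqxx !orbT.
Qed.

End FromSemiConditional.

(** * The two inclusions *)

Theorem mainTheorem6 (T : finType) (L : seq T -> Prop) :
  RE L <-> SCM 6 3 4 7 2 3 L.
Proof.
split=> [[G [Gwf LG]]|[G [_ LG]]]; first exact: simulating_SCM Gwf L LG.
exists (machine_grammar (inl 0) (scm_rules G)); split; first exact: machine_wf.
by move=> y; rewrite LG scm_machineP.
Qed.
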